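(* Let $d$ be a real number with $1 \le d < \sqrt{3}$, and let $\mathbf{D} \in \mathcal{F}(d)$ be an arbitrary disk-polygon with center parameter $d$ in the Euclidean plane $\mathbb{E}^2$. Then the minimal width of $\mathbf{D}$ is at least as large as the minimal width of $\Delta(d)$, i.e. $$w(\mathbf{D}) \ge w(\Delta(d)).$$
   Context: A disk-polygon is an intersection, with non-empty interior, of finitely many closed circular disks of unit radius in the Euclidean plane $\mathbb{E}^2$. Whenever a disk-polygon is considered, the disks generating it (its generating disks) are assumed to be all needed: each of them contributes to the boundary of the disk-polygon through a circular arc (called a side), and consecutive sides meet in the vertices of the disk-polygon. For $0<d<\sqrt{3}$, a disk-polygon $\mathbf{D}$ is called a disk-polygon with center parameter $d$ if the distance between any two centers of the generating disks of $\mathbf{D}$ is at most $d$. $\mathcal{F}(d)$ denotes the family of all disk-polygons with center parameter $d$. For $1\le d<\sqrt{3}$, $\Delta(d)$ denotes the regular disk-triangle whose three generating unit disks are centered at the vertices of a regular (equilateral) triangle of side length $d$, i.e. the intersection of these three closed unit disks (determined up to congruence). A convex domain is a compact convex set with non-empty interior in $\mathbb{E}^2$. The minimal width $w(\mathbf{C})$ of a convex domain $\mathbf{C}$ is the smallest distance between two parallel supporting lines of $\mathbf{C}$. *)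

(* Defs.v *)
From HB Require Import structures.
From mathcomp Require Import all_boot all_order all_algebra.
From mathcomp Require Import all_classical all_reals all_analysis.
Set Implicit Arguments.
Unset Strict Implicit.
Unset Printing Implicit Defensive.
Import Order.TTheory GRing.Theory Num.Theory.
Import numFieldNormedType.Exports.
Local Open Scope classical_set_scope.
Local Open Scope ring_scope.

(* The norm that the library puts on R * R is the sup norm. It is used here
   only through its topology, which is the Euclidean one; lengths and
   distances are those of [edist]. *)
Notation plane R := (R * R)%type.

Definition dot (R : realType) (p q : plane R) : R := p.1 * q.1 + p.2 * q.2.

Definition edist (R : realType) (p q : plane R) : R :=
  Num.sqrt (dot (p - q) (p - q)).

Definition unit_disk (R : realType) (c : plane R) : set (plane R) :=
  [set p | edist p c <= 1].

Definition disk_inter (R : realType) (X : set (plane R)) : set (plane R) :=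
  \bigcap_(c in X) unit_disk c.

Definition boundary (R : realType) (C : set (plane R)) : set (plane R) :=
  closure C `\` C°.

Definition unit_arc (R : realType) (c : plane R) (a b : R) : set (plane R) :=
  [set c + (cos t, sin t) | t in `[a, b]].

(* [X] is the set of centers of the generating disks of the disk-polygon [D];
   the last clause says that every generating disk contributes a
   non-degenerate arc to the boundary of [D]. A single disk is allowed; the
   empty family, whose intersection is the whole plane, is not. *)
Definition generates (R : realType) (X D : set (plane R)) : Prop :=
  [/\ finite_set X /\ X !=set0, D = disk_inter X, D° !=set0 &
      forall c, X c -> exists a b : R, a < b /\ unit_arc c a b `<=` boundary D].

(* The family F(d). *)
Definition center_param_family (R : realType) (d : R) : set (set (plane R)) :=
  [set D | exists X : set (plane R),
     generates X D /\ forall x y, X x -> X y -> edist x y <= d].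

(* The copies of Delta(d): it is only determined up to congruence. *)
Definition regular_disk_triangle (R : realType) (d : R) : set (set (plane R)) :=
  [set T | exists a b c : plane R,
     [/\ edist a b = d, edist b c = d, edist c a = d &
         T = disk_inter [set a; b; c]]].

(* Lines are given by a unit normal [u] and an offset [a]. *)
Definition line (R : realType) (u : plane R) (a : R) : set (plane R) :=
  [set p | dot u p = a].

Definition supporting_line (R : realType) (C : set (plane R))
    (u : plane R) (a : R) : Prop :=
  C `&` line u a !=set0 /\
  (C `<=` [set p | dot u p <= a] \/ C `<=` [set p | a <= dot u p]).

Definition set_dist (R : realType) (A B : set (plane R)) : R :=
  inf [set edist p q | p in A & q in B].

(* For a convex domain the set below is non-empty and bounded below by 0, and
   its infimum is attained. The two supporting lines are required to be
   distinct: otherwise the infimum would be 0 for every non-empty compact [C]. *)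
Definition minimal_width (R : realType) (C : set (plane R)) : R :=
  inf [set w | exists (u : plane R) (a b : R),
     [/\ dot u u = 1, a != b, supporting_line C u a, supporting_line C u b &
         w = set_dist (line u a) (line u b)]].

(* Main.v *)
Require Import Defs.
From HB Require Import structures.
From mathcomp Require Import all_boot all_order all_algebra.
From mathcomp Require Import ring lra.
From mathcomp Require Import all_classical all_reals all_analysis.
Import Order.TTheory GRing.Theory Num.Theory.
Import numFieldNormedType.Exports.
Local Open Scope classical_set_scope.
Local Open Scope ring_scope.

(* In a direction [u] let [p] and [q] be a highest and a lowest point of [D].
   If [p = c + u] for a center [c], then [D] has a point at height
   [center_vertex_dist d] above [c]: this level meets every lens spanned by two
   generating disks, so by Helly's theorem on the line it meets [D]. Hence the
   width in direction [u] is at least [1 - center_vertex_dist d], which is the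
   width of Delta(d) along an axis of symmetry. If neither [p] nor [q] lies on
   an arc with normal [u], rotate [u] towards the side on which [u . (p - q)]
   decreases, until [u] is the normal of an arc ending in [p] or in [q]; up to
   that moment [p] and [q] remain extreme, so the previous case applies. *)

(* For Delta(d) with centers [a], [b], [c]: the distance from [a] to the vertex
   where the circles around [b] and [c] meet on the side of [a]. *)
Definition center_vertex_dist {R : realType} (d : R) : R :=
  Num.sqrt 3 / 2 * d - Num.sqrt (1 - d ^+ 2 / 4).

(** * Square roots and estimates for [center_vertex_dist] *)

(** Trades a root for a variable with polynomial properties, the form that [nra] can use. *)
Lemma sqrt_spec {R : realType} (x : R) : 0 <= x ->
  exists2 y : R, Num.sqrt x = y & 0 <= y /\ y * y = x.
Proof.
by move=> x0; exists (Num.sqrt x) => //; rewrite sqrtr_ge0 -expr2 sqr_sqrtr.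
Qed.

Lemma le_sqr {R : realType} (x y : R) : 0 <= y -> x * x <= y * y -> x <= y.
Proof. by move=> y0 xy; rewrite leNgt; apply/negP => yx; nra. Qed.

Lemma lt_sqr {R : realType} (x y : R) : 0 <= y -> x * x < y * y -> x < y.
Proof. by move=> y0 xy; rewrite ltNge; apply/negP => yx; nra. Qed.

(** Serves the case where the lowest point of a lens is the bottom of a disk whose center has height
    at most [d]. *)
Lemma center_vertex_dist_ge {R : realType} (d : R) : 1 <= d -> d * d <= 3 ->
  d - 1 <= center_vertex_dist d.
Proof.
move=> d1 d3; rewrite /center_vertex_dist expr2.
have [r -> [r0 r3]] := @sqrt_spec R 3 ltac:(lra).
have [k -> [k0 kE]] := @sqrt_spec _ (1 - d * d / 4) ltac:(lra).
have r1 : 17/10 <= r by nra.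
have r2 : r <= 2 by nra.
rewrite lerBrDr -lerBrDl; apply: le_sqr; first by nra.
rewrite kE.
(* Since [r * r = 3], this product is exactly the difference of the two squares. *)
have : 0 <= (2 - r) * (d * (d - 1)) by apply: mulr_ge0; nra.
have -> : (r / 2 * d - (d - 1)) * (r / 2 * d - (d - 1)) =
  1 + (r * r / 4 + 1 - r) * (d * d) - (2 - r) * d by field.
rewrite r3; lra.
Qed.

Lemma center_vertex_dist_lt1 {R : realType} (d : R) :
  1 <= d -> d < Num.sqrt 3 -> center_vertex_dist d < 1.
Proof.
rewrite /center_vertex_dist expr2.
have [r -> [r0 r3]] := @sqrt_spec R 3 ltac:(lra).
move=> d1 dr.
have k2 : 0 <= 1 - d * d / 4 by nra.
have [k -> [k0 kE]] := sqrt_spec _ k2.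
suff : r / 2 * d - 1 < k by lra.
apply: lt_sqr => //; rewrite kE; nra.
Qed.

(** * Lowest points of lenses spanned by two unit disks *)

(** [A - k] is the distance from the apex of an isosceles triangle with legs [d] and base [e] to the
    nearer vertex of the lens around the base points. The product of [A - k] and [A + k] is
    [d * d - 1] for every [e], while [A + k] decreases in [e]; so the gap is largest at [e = d]. *)
Lemma chord_gap_le {R : realType} (d e A k : R) : 1 <= d -> d * d <= 3 ->
  0 <= e -> e <= d -> 0 <= A -> A * A = d * d - e * e / 4 ->
  0 <= k -> k * k = 1 - e * e / 4 ->
  0 <= A - k <= center_vertex_dist d.
Proof.
move=> d1 d3 e0 ed A0 AE k0 kE; rewrite /center_vertex_dist expr2.
have [r -> [r0 r3]] := @sqrt_spec R 3 ltac:(lra).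
have [k' -> [k'0 k'E]] := @sqrt_spec _ (1 - d * d / 4) ltac:(lra).
have kA : k <= A by apply: le_sqr => //; nra.
have k'k : k' <= k by apply: le_sqr => //; nra.
have rA : r / 2 * d <= A by apply: le_sqr => //; nra.
have r1 : 1 <= r by nra.
apply/andP; split; first lra.
have E1 : (A - k) * (A + k) = (r / 2 * d - k') * (r / 2 * d + k').
  transitivity (d * d - 1); first by rewrite mulrDr; nra.
  by nra.
have p0 : 0 < r / 2 * d + k' by nra.
rewrite -(ler_pM2r p0) -E1.
apply: ler_wpM2l; lra.
Qed.

(** For first-quadrant angles t0 <= t <= t1 this is the monotonicity of cos (t1 - t) in t. *)
Lemma cos_diff_mono {R : realType} (c0 s0 c s c1 s1 : R) :
  c0 * c0 + s0 * s0 = 1 -> c * c + s * s = 1 -> c1 * c1 + s1 * s1 = 1 ->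
  0 <= c0 -> 0 <= c -> 0 <= c1 -> 0 < s0 -> s0 <= s -> s <= s1 ->
  c1 * c0 + s1 * s0 <= c1 * c + s1 * s.
Proof.
move=> h0 h h1 c0p cp c1p s0p s0s ss1.
have c1c : c1 <= c by apply: le_sqr => //; nra.
have cc0 : c <= c0 by apply: le_sqr => //; nra.
have sp : 0 < s + s0 by lra.
(* The factor [s + s0] turns [s - s0] into a multiple of [c0 - c], which can then be factored
   out. *)
rewrite -subr_ge0 -(pmulr_lge0 _ sp).
have -> : (c1 * c + s1 * s - (c1 * c0 + s1 * s0)) * (s + s0)
  = (c0 - c) * (s1 * (c0 + c) - c1 * (s + s0)).
  have : (s - s0) * (s + s0) = (c0 - c) * (c0 + c) by nra.
  by move=> E; rewrite mulrBr [_ * (s1 * _)]mulrCA -E; ring.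
apply: mulr_ge0; first lra.
rewrite subr_ge0 ![_ * (_ + _)]mulrDr; nra.
Qed.

(* The lens is spanned by centers at distance [e] in direction [(C, S)], with
   midpoint [al * (- S, C) + be * (C, S)] relative to the center [c] of the main
   argument; its lower vertex lies [k] below the midpoint along [(- S, C)]. The
   condition [2 * S <= e] says that the vertex is the lowest point of the lens. *)
Lemma lens_vertex_height {R : realType} (d e C S al be k : R) :
  1 <= d -> d * d <= 3 -> 0 < e -> e <= d ->
  0 <= C -> 0 <= S -> C * C + S * S = 1 -> 2 * S <= e ->
  0 <= k -> k * k = 1 - e * e / 4 ->
  al * al + (be + e / 2) * (be + e / 2) <= d * d ->
  al * al + (be - e / 2) * (be - e / 2) <= d * d ->
  al * C + be * S - k * C <= center_vertex_dist d.
Proof.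
move=> d1 d3 e0 ed C0 S0 CS Se k0 kE hx hy.
have A2 : 0 <= d * d - e * e / 4 by nra.
have [A _ [A0 AE]] := sqrt_spec _ A2.
have /andP[g0 gs] := chord_gap_le d e A k d1 d3 (ltW e0) ed A0 AE k0 kE.
have Ap : 0 < A by rewrite lt_neqAle A0 andbT; apply/negP => /eqP A00; nra.
have C1 : C <= 1 by nra.
(* The admissible [(al, be)] form a lens of two disks of radius [d]. Its extreme point in direction
   [(C, S)] is the vertex [(A, 0)] if [S * d <= e / 2], and lies on an arc otherwise. *)
have [low|high] := leP (S * d) (e / 2).
  have lowA : S * A <= C * (e / 2).
    have Ad : A * A + e * e / 4 = d * d by lra.
    apply: le_sqr; first by nra.
    have : (S * d) * (S * d) <= (e / 2) * (e / 2) by apply: ler_pM; nra.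
    nra.
  suff : al * C + be * S <= A * C by nra.
  have b0 := normr_ge0 be.
  have bb : `|be| * `|be| = be * be by rewrite -normrM ger0_norm //; nra.
  have ble : be <= `|be| by exact: ler_norm.
  have alA : 2 * A * al <= 2 * A * A - `|be| * e.
    have : al * al + be * be + `|be| * e <= A * A.
      by have [b|b] := lerP 0 be; [rewrite ger0_norm|rewrite ltr0_norm]; nra.
    have := sqr_ge0 (A - al); rewrite expr2; nra.
  rewrite -(ler_pM2l Ap).
  have h1 : A * al * C <= (A * A - `|be| * (e / 2)) * C.
    by apply: ler_wpM2r => //; lra.
  have h2 : be * (S * A) <= `|be| * (C * (e / 2)).
    apply: (@le_trans _ _ (`|be| * (S * A))).
      by apply: ler_wpM2r => //; nra.
    by apply: ler_wpM2l.
  nra.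
have dp : 0 < d by lra.
have xd : al * C + (be + e / 2) * S <= d.
  apply: le_sqr; first lra.
  have := sqr_ge0 (al * S - (be + e / 2) * C); rewrite expr2; nra.
(* [(c0, s0)] is the direction where the two cases meet. As [(k, e / 2)] is a unit vector at a
   larger angle, [k * C + e / 2 * S] is smallest there. *)
set s0 := e / 2 / d; set c0 := A / d.
have s0d : s0 * d = e / 2 by rewrite /s0 mulfVK // gt_eqF.
have c0d : c0 * d = A by rewrite /c0 mulfVK // gt_eqF.
have := cos_diff_mono c0 s0 C S k (e / 2).
have h0 : c0 * c0 + s0 * s0 = 1.
  apply: (@mulIf _ (d * d)); first by rewrite gt_eqF //; nra.
  transitivity ((c0 * d) * (c0 * d) + (s0 * d) * (s0 * d)); first ring.
  by rewrite s0d c0d AE; lra.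
move=> /(_ h0 CS ltac:(nra) ltac:(nra) C0 k0) hh.
have {}hh : k * c0 + e / 2 * s0 <= k * C + e / 2 * S.
  apply: hh; [nra | | lra].
  by rewrite /s0 ler_pdivrMr // ltW.
suff : d - center_vertex_dist d <= k * c0 + e / 2 * s0 by nra.
have -> : k * c0 + e / 2 * s0 = (k * A + e / 2 * (e / 2)) / d.
  by rewrite /c0 /s0; field; rewrite gt_eqF.
rewrite ler_pdivlMr //.
(* With [d] cleared, the claim is that [A * (A - k)] is at most [d * center_vertex_dist d]. *)
have Ad : A <= d by apply: le_sqr; nra.
nra.
Qed.

(** The origin is the center [c], and heights are second coordinates. As [x] is the higher center,
    the lowest point of the lens is the bottom of the disk around [x] or the lower vertex. *)
Lemma lens_low_point_ordered {R : realType} (d x1 x2 y1 y2 : R) :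
  1 <= d -> d * d <= 3 -> y2 <= x2 ->
  x1 * x1 + x2 * x2 <= d * d -> y1 * y1 + y2 * y2 <= d * d ->
  (x1 - y1) * (x1 - y1) + (x2 - y2) * (x2 - y2) <= d * d ->
  exists z1 z2, [/\ (z1 - x1) * (z1 - x1) + (z2 - x2) * (z2 - x2) <= 1,
    (z1 - y1) * (z1 - y1) + (z2 - y2) * (z2 - y2) <= 1 &
    z2 <= center_vertex_dist d].
Proof.
move=> d1 d3 yx hx hy hxy.
set E := (x1 - y1) * (x1 - y1) + (x2 - y2) * (x2 - y2) in hxy.
(* [arc] says that the bottom of the disk around [x] lies in the disk around [y]. *)
have [arc|vertex] := leP E (2 * (x2 - y2)).
  exists x1, (x2 - 1); split.
  - by rewrite subrr mul0r add0r; lra.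
  - by rewrite /E in arc; nra.
  - apply: le_trans (center_vertex_dist_ge d d1 d3).
    by rewrite lerB //; apply: le_sqr; nra.
have E0 : 0 <= E by lra.
have [e _ [e0 eE]] := sqrt_spec _ E0.
have ep : 0 < e by rewrite lt_neqAle e0 andbT; apply/negP => /eqP e00; nra.
have ed : e <= d by apply: le_sqr; nra.
have k2 : 0 <= 1 - e * e / 4 by nra.
have [k _ [k0 kE]] := sqrt_spec _ k2.
have [t1 t1E] : {t1 | x1 - y1 = e * t1}.
  by exists ((x1 - y1) / e); rewrite mulrCA mulfV ?mulr1 // gt_eqF.
have [t2 t2E] : {t2 | x2 - y2 = e * t2}.
  by exists ((x2 - y2) / e); rewrite mulrCA mulfV ?mulr1 // gt_eqF.
have tt : t1 * t1 + t2 * t2 = 1.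
  have ee0 : e * e != 0 by rewrite mulf_neq0 // gt_eqF.
  apply: (mulIf ee0); rewrite mul1r [RHS]eE /E t1E t2E; ring.
have t20 : 0 <= t2 by rewrite -(pmulr_rge0 _ ep) -t2E; lra.
have t2e : 2 * t2 <= e by rewrite -(ler_pM2l ep) eE; lra.
set m1 := (x1 + y1) / 2; set m2 := (x2 + y2) / 2.
have x1E : x1 = m1 + e / 2 * t1 by rewrite /m1; lra.
have y1E : y1 = m1 - e / 2 * t1 by rewrite /m1; lra.
have x2E : x2 = m2 + e / 2 * t2 by rewrite /m2; lra.
have y2E : y2 = m2 - e / 2 * t2 by rewrite /m2; lra.
clearbody m1 m2; clear E hxy vertex E0 eE t1E t2E yx.
(* [sg] reflects the first axis, so that the direction [(sg * t1, t2)] lies in the first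
   quadrant. *)
have [sg [sg2 sgt]] : exists sg, sg * sg = 1 /\ 0 <= sg * t1.
  have [t10|t10] := lerP 0 t1; first by exists 1; lra.
  by exists (-1); lra.
have CS : sg * t1 * (sg * t1) + t2 * t2 = 1.
  by rewrite mulrACA sg2 mul1r.
(* The lower vertex: [k] away from the midpoint, perpendicular to the line of centers. *)
exists (m1 + k * (sg * t2)), (m2 - k * (sg * t1)); split.
- rewrite x1E x2E; rewrite le_eqVlt; apply/orP; left; apply/eqP.
  transitivity (k * k * ((sg * t1) * (sg * t1) + sg * sg * (t2 * t2))
    + e * e / 4 * (t1 * t1 + t2 * t2)); first by field.
  by rewrite sg2 mul1r CS tt kE; field.
- rewrite y1E y2E; rewrite le_eqVlt; apply/orP; left; apply/eqP.
  transitivity (k * k * ((sg * t1) * (sg * t1) + sg * sg * (t2 * t2))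
    + e * e / 4 * (t1 * t1 + t2 * t2)); first by field.
  by rewrite sg2 mul1r CS tt kE; field.
have := lens_vertex_height d e (sg * t1) t2 (m2 * (sg * t1) - sg * m1 * t2)
  (sg * m1 * (sg * t1) + m2 * t2) k d1 d3 ep ed sgt t20 CS t2e k0 kE.
set al := m2 * _ - _; set be := sg * m1 * (sg * t1) + _.
have beE : be = m1 * t1 + m2 * t2.
  by rewrite /be mulrACA sg2 mul1r.
have alal : al * al = (m2 * t1 - m1 * t2) * (m2 * t1 - m1 * t2).
  transitivity (sg * sg * ((m2 * t1 - m1 * t2) * (m2 * t1 - m1 * t2))).
    by rewrite /al; ring.
  by rewrite sg2 mul1r.
have nE (r : R) : al * al + (be + r) * (be + r) =
    (m1 + r * t1) * (m1 + r * t1) + (m2 + r * t2) * (m2 + r * t2).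
  rewrite alal beE.
  transitivity ((m1 * m1 + m2 * m2) * (t1 * t1 + t2 * t2) +
     2 * r * (m1 * t1 + m2 * t2) + r * r); first ring.
  transitivity (m1 * m1 + m2 * m2 +
     2 * r * (m1 * t1 + m2 * t2) + r * r * (t1 * t1 + t2 * t2)); last ring.
  by rewrite tt !mulr1.
rewrite nE -x1E -x2E => /(_ hx); rewrite nE !mulNr -y1E -y2E => /(_ hy).
apply: le_trans; rewrite lerD2r; rewrite le_eqVlt; apply/orP; left; apply/eqP.
transitivity (m2 * (sg * t1 * (sg * t1) + t2 * t2)); first by rewrite CS mulr1.
by rewrite /al /be; ring.
Qed.

Lemma lens_low_point {R : realType} (d x1 x2 y1 y2 : R) :
  1 <= d -> d * d <= 3 ->
  x1 * x1 + x2 * x2 <= d * d -> y1 * y1 + y2 * y2 <= d * d ->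
  (x1 - y1) * (x1 - y1) + (x2 - y2) * (x2 - y2) <= d * d ->
  exists z1 z2, [/\ (z1 - x1) * (z1 - x1) + (z2 - x2) * (z2 - x2) <= 1,
    (z1 - y1) * (z1 - y1) + (z2 - y2) * (z2 - y2) <= 1 &
    z2 <= center_vertex_dist d].
Proof.
move=> d1 d3 hx hy hxy; have [yx|/ltW xy] := leP y2 x2.
  exact: lens_low_point_ordered.
have hyx : (y1 - x1) * (y1 - x1) + (y2 - x2) * (y2 - x2) <= d * d by lra.
have [z1 [z2 [? ? ?]]] := lens_low_point_ordered d y1 y2 x1 x2 d1 d3 xy hy hx hyx.
by exists z1, z2.
Qed.

(** * Helly's theorem on a horizontal line *)

Lemma max_seq {T : eqType} {R : realType} (f : T -> R) (s : seq T) x0 :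
  x0 \in s -> exists2 x, x \in s & forall y, y \in s -> f y <= f x.
Proof.
elim: s x0 => // a [|b s] IH x0 _.
  by exists a; [rewrite mem_head | move=> y; rewrite inE => /eqP ->].
have [x xs xm] := IH b (mem_head b s).
have [ax|xa] := leP (f a) (f x).
  exists x; first by rewrite inE xs orbT.
  by move=> y; rewrite inE => /orP[/eqP ->//|]; exact: xm.
exists a; first exact: mem_head.
move=> y; rewrite inE => /orP[/eqP ->//|/xm yx]; lra.
Qed.

(** The disks cut the line at height [h] in intervals that meet pairwise; the largest left endpoint
    lies in all of them. *)
Lemma disks_meet_level {R : realType} {T : eqType} (S : seq T)
    (f g : T -> R) (h : R) :
  (forall x y, x \in S -> y \in S -> exists t,
    (t - f x) * (t - f x) + (h - g x) * (h - g x) <= 1 /\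
    (t - f y) * (t - f y) + (h - g y) * (h - g y) <= 1) ->
  exists t, forall x, x \in S ->
    (t - f x) * (t - f x) + (h - g x) * (h - g x) <= 1.
Proof.
case: S => [|x0 S] H; first by exists 0.
set r := fun x => Num.sqrt (1 - (h - g x) * (h - g x)).
have r0 x : 0 <= r x by exact: sqrtr_ge0.
have rE x : x \in x0 :: S -> r x * r x = 1 - (h - g x) * (h - g x).
  move=> xS; rewrite -expr2 sqr_sqrtr // subr_ge0.
  have [t [tx _]] := H _ _ xS xS; have := sqr_ge0 (t - f x); rewrite expr2; lra.
have bnd t x : x \in x0 :: S ->
    (t - f x) * (t - f x) + (h - g x) * (h - g x) <= 1 ->
    f x - r x <= t <= f x + r x.
  move=> xS tx; have rx := rE _ xS; have := r0 x.
  by move=> ?; apply/andP; split; rewrite leNgt; apply/negP => ?; nra.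
have [x xS xm] := max_seq (fun x => f x - r x) _ _ (mem_head x0 S).
exists (f x - r x) => y yS; have ry := rE _ yS; have := r0 y => ry0.
have [t [tx ty]] := H _ _ xS yS.
have /andP[tx1 _] := bnd _ _ xS tx.
have /andP[_ ty2] := bnd _ _ yS ty.
have := xm _ yS => yx.
nra.
Qed.

(** With [c] as origin, (0, 1) lies in every disk. The segment from it to a low point of a lens
    stays in the lens and crosses the level [center_vertex_dist d], so any two disks meet on this
    level. *)
Lemma low_point_inter {R : realType} {T : eqType} (S : seq T)
    (f g : T -> R) (d : R) :
  1 <= d -> d < Num.sqrt 3 ->
  (forall x, x \in S -> f x * f x + (1 - g x) * (1 - g x) <= 1) ->
  (forall x, x \in S -> f x * f x + g x * g x <= d * d) ->
  (forall x y, x \in S -> y \in S ->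
     (f x - f y) * (f x - f y) + (g x - g y) * (g x - g y) <= d * d) ->
  exists t, forall x, x \in S -> (t - f x) * (t - f x) +
    (center_vertex_dist d - g x) * (center_vertex_dist d - g x) <= 1.
Proof.
move=> d1 dr htop hd hdd.
have d3 : d * d <= 3.
  have := @sqrt_spec R 3 ltac:(lra); case=> r re [r0 r3]; rewrite re in dr.
  nra.
have s1 := center_vertex_dist_lt1 d d1 dr.
set s := center_vertex_dist d in s1 *.
apply: disks_meet_level => x y xS yS.
have [z1 [z2 [zx zy zs]]] :=
  lens_low_point d _ _ _ _ d1 d3 (hd _ xS) (hd _ yS) (hdd _ _ xS yS).
have {}zs : z2 <= s by [].
clearbody s.
have hx := htop _ xS; have hy := htop _ yS.
(* The weight that puts the convex combination of [(z1, z2)] and (0, 1) at height [s]. *)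
set l := (1 - s) / (1 - z2).
have l0 : 0 <= l by apply: divr_ge0; lra.
have l1 : l <= 1 by rewrite ler_pdivrMr ?mul1r; lra.
have lE : l * (1 - z2) = 1 - s by rewrite mulfVK // subr_eq0 gt_eqF //; lra.
have sE : s = l * z2 + (1 - l) by lra.
have conv (a b : R) : (l * z1 - a) * (l * z1 - a) + (s - b) * (s - b) <=
   l * ((z1 - a) * (z1 - a) + (z2 - b) * (z2 - b)) +
   (1 - l) * (a * a + (1 - b) * (1 - b)).
  rewrite sE -subr_ge0.
  rewrite (_ : _ - _ = l * (1 - l) * (z1 * z1 + (z2 - 1) * (z2 - 1))); last ring.
  apply: mulr_ge0; first by apply: mulr_ge0; lra.
  by rewrite addr_ge0 // -expr2 sqr_ge0.
by exists (l * z1); split; apply: le_trans (conv _ _) _; nra.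
Qed.

(** * Dot products and orthonormal frames *)

Lemma dotC {R : realType} (p q : plane R) : dot p q = dot q p.
Proof. by rewrite /dot !(mulrC q.1) !(mulrC q.2). Qed.

Lemma dotBr {R : realType} (p q r : plane R) :
  dot p (q - r) = dot p q - dot p r.
Proof. by rewrite /dot /=; ring. Qed.

Lemma dotDr {R : realType} (p q r : plane R) :
  dot p (q + r) = dot p q + dot p r.
Proof. by rewrite /dot /=; ring. Qed.

Lemma dotNl {R : realType} (p q : plane R) : dot (- p) q = - dot p q.
Proof. by rewrite /dot /=; ring. Qed.

Lemma dotNr {R : realType} (p q : plane R) : dot p (- q) = - dot p q.
Proof. by rewrite /dot /=; ring. Qed.

Lemma dotDl {R : realType} (p q r : plane R) :
  dot (q + r) p = dot q p + dot r p.
Proof. by rewrite /dot /=; ring. Qed.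

Lemma dotZr {R : realType} (a : R) (p q : plane R) : dot p (a *: q) = a * dot p q.
Proof. by rewrite /dot /= /GRing.scale /=; ring. Qed.

Lemma dot_ge0 {R : realType} (p : plane R) : 0 <= dot p p.
Proof. by rewrite /dot addr_ge0 // -expr2 sqr_ge0. Qed.

Lemma dot_eq0 {R : realType} (p : plane R) : dot p p = 0 -> p = 0.
Proof.
case: p => a b; rewrite /dot /= => /eqP; rewrite -!expr2 paddr_eq0 ?sqr_ge0 //.
by rewrite !sqrf_eq0 => /andP[/eqP -> /eqP ->].
Qed.

Lemma plane_edist_le {R : realType} (p q : plane R) (d : R) : 0 <= d ->
  (Defs.edist p q <= d) = (dot (p - q) (p - q) <= d * d).
Proof.
by move=> d0; rewrite /Defs.edist -expr2 -{2}(sqr_sqrtr (dot_ge0 (p - q)))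
  ler_pXn2r // nnegrE ?sqrtr_ge0.
Qed.

(** The sign of [v] is chosen against [w]: for [w = p - q], this is the side to which [u] is
    rotated. *)
Lemma frame_ex {R : realType} (u w : plane R) : dot u u = 1 ->
  exists v, [/\ dot v v = 1, dot u v = 0 & dot v w <= 0].
Proof.
move=> uu; pose v : plane R := (- u.2, u.1).
have vv : dot v v = 1 by rewrite -uu /dot /=; ring.
have uv : dot u v = 0 by rewrite /dot /=; ring.
have [vw|/ltW vw] := leP (dot v w) 0; first by exists v.
by exists (- v); rewrite !dotNl !dotNr opprK uv oppr0 oppr_le0.
Qed.

Lemma dot_frame {R : realType} (u v p q : plane R) :
  dot u u = 1 -> dot v v = 1 -> dot u v = 0 ->
  dot p q = dot v p * dot v q + dot u p * dot u q.
Proof.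
case: u v p q => [u1 u2] [v1 v2] [p1 p2] [q1 q2]; rewrite /dot /=.
(* [D] is the determinant of the frame; it is 1 or -1, and [v] is [D] times the quarter turn of
   [u]. *)
move=> uu vv uv; set D := u1 * v2 - u2 * v1.
have v1E : v1 = - (D * u2).
  rewrite /D; transitivity (v1 * (u1 * u1 + u2 * u2) - u1 * (u1 * v1 + u2 * v2)).
    by rewrite uu uv; ring.
  ring.
have v2E : v2 = D * u1.
  rewrite /D; transitivity (v2 * (u1 * u1 + u2 * u2) - u2 * (u1 * v1 + u2 * v2)).
    by rewrite uu uv; ring.
  ring.
have DD : D * D = 1.
  transitivity ((u1 * u1 + u2 * u2) * (v1 * v1 + v2 * v2) -
      (u1 * v1 + u2 * v2) * (u1 * v1 + u2 * v2)); first by rewrite /D; ring.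
  by rewrite uu vv uv; ring.
clearbody D; rewrite v1E v2E.
transitivity ((p1 * q1 + p2 * q2) * (u1 * u1 + u2 * u2)); first by rewrite uu mulr1.
transitivity (D * D * ((u1 * p2 - u2 * p1) * (u1 * q2 - u2 * q1)) +
   (u1 * p1 + u2 * p2) * (u1 * q1 + u2 * q2)); last ring.
by rewrite DD; ring.
Qed.

(** * Extreme points of an intersection of unit disks *)

Definition disks_inter {R : realType} (S : seq (plane R)) (p : plane R) : Prop :=
  forall x, x \in S -> dot (p - x) (p - x) <= 1.

(** Coordinates along [v] and [u] from [c] turn [c + u] into (0, 1), which reduces this to
    [low_point_inter]. *)
Lemma low_point {R : realType} (S : seq (plane R)) (d : R) (c u : plane R) :
  1 <= d -> d < Num.sqrt 3 ->
  (forall x y, x \in S -> y \in S -> dot (x - y) (x - y) <= d * d) ->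
  dot u u = 1 -> c \in S -> disks_inter S (c + u) ->
  exists2 q, disks_inter S q & dot u (q - c) <= center_vertex_dist d.
Proof.
move=> d1 d3 Sd uu cS cuS.
have [v [vv uv _]] := frame_ex u 0 uu.
have frame p := dot_frame u v p p uu vv uv.
have vu : dot v u = 0 by rewrite dotC.
have [|||t tS] := low_point_inter S (fun x => dot v (x - c))
    (fun x => dot u (x - c)) d d1 d3.
- move=> x /cuS; rewrite frame !dotBr !dotDr uu vu; lra.
- by move=> x xS; rewrite -frame Sd.
- move=> x y xS yS; have := Sd _ _ xS yS; rewrite frame !dotBr; lra.
exists (c + t *: v + center_vertex_dist d *: u).
  move=> x /tS; rewrite frame !dotBr !dotDr !dotZr uu vv uv vu; lra.
by rewrite !dotBr !dotDr !dotZr uu uv; lra.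
Qed.

(* The parabola, unlike a line, enters the disk also from its lowest point. *)
Lemma parabola_in_unit_disk {R : realType} (a b : R) :
  a * a + b * b <= 1 -> (a * a + b * b = 1 -> a <= 0) -> (a = 0 -> b != 1) ->
  exists2 e, 0 < e & forall t, 0 < t -> t <= e ->
    (a + t) * (a + t) + (b + t * t) * (b + t * t) <= 1.
Proof.
move=> ab1 ale ane.
have a1 : a <= 1 by apply: le_sqr; nra.
have b1 : b <= 1 by apply: le_sqr; nra.
have poly t : 0 < t -> t <= 1 ->
    [/\ 0 <= t * t, t * t <= t, b * (t * t) <= t * t & t * t * (t * t) <= t * t].
  move=> t0 t1; have tt : t * t <= t by nra.
  by split=> //; nra.
have [lt1|ge1] := ltP (a * a + b * b) 1.
  (* For [t <= 1] the added terms [2 * a * t], [t ^ 2], [2 * b * t ^ 2], [t ^ 4] sum to at most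
     [6 * t]. *)
  exists (Num.min 1 ((1 - (a * a + b * b)) / 6)).
    by rewrite lt_min ltr01 /=; lra.
  move=> t t0; rewrite le_min => /andP[t1 te].
  have [? ? ? ?] := poly t t0 t1.
  have ? : a * t <= t by nra.
  nra.
have e1 : a * a + b * b = 1 by apply/le_anti/andP.
have := ale e1; rewrite le_eqVlt => /orP[/eqP a0|a0].
  have /eqP : (b - 1) * (b + 1) = 0 by move: e1; rewrite a0; lra.
  rewrite mulf_eq0 subr_eq0 (negbTE (ane a0)) /= => /eqP b0.
  exists 1 => // t t0 t1; have [? ? ? ?] := poly t t0 t1.
  have -> : b = -1 by lra.
  rewrite a0; nra.
(* The negative term [2 * a * t] outweighs the others, which sum to at most [4 * t ^ 2]. *)
exists (Num.min 1 (- a / 2)); first by rewrite lt_min ltr01 /=; lra.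
move=> t t0; rewrite le_min => /andP[t1 te].
have [? ? ? ?] := poly t t0 t1.
nra.
Qed.

Lemma seq_uniform_pos {R : realType} {T : eqType} (P : T -> R -> Prop) (S : seq T) :
  (forall x, x \in S -> exists2 e, 0 < e & forall t, 0 < t -> t <= e -> P x t) ->
  exists2 t, 0 < t & forall x, x \in S -> P x t.
Proof.
move=> H; suff [e e0 He] : exists2 e, 0 < e &
    forall x, x \in S -> forall t, 0 < t -> t <= e -> P x t.
  by exists e => // x /He; apply.
elim: S H => [|x S IH] H; first by exists 1.
have [|e e0 He] := IH; first by move=> y yS; apply: H; rewrite inE yS orbT.
have [e' e'0 He'] := H x (mem_head x S).
exists (Num.min e e'); first by rewrite lt_min e0.
move=> y; rewrite inE => /orP[/eqP ->|yS] t t0; rewrite le_min => /andP[te te'].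
  exact: He'.
exact: He.
Qed.

(** If both alternatives fail, the parabola from [p] with tangent [v], bending towards [u], stays in
    every disk for small [t > 0] and rises above [p]. *)
Lemma top_point_normal {R : realType} (S : seq (plane R)) (p u v : plane R) :
  dot u u = 1 -> dot v v = 1 -> dot u v = 0 -> disks_inter S p ->
  (forall z, disks_inter S z -> dot u z <= dot u p) ->
  (exists2 x, x \in S & p = x + u) \/
  (exists x, [/\ x \in S, dot (p - x) (p - x) = 1 & 0 < dot v (p - x)]).
Proof.
move=> uu vv uv pS ptop; apply: contrapT => /not_orP[Nu Nv].
have frame q := dot_frame u v q q uu vv uv.
have vu : dot v u = 0 by rewrite dotC.
have [|t t0 tS] := seq_uniform_pos (fun x t =>
    disks_inter [:: x] (p + t *: v + (t * t) *: u)) S.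
  move=> x xS; have pert := parabola_in_unit_disk (dot v (p - x)) (dot u (p - x)).
  have [|||e e0 He] := pert.
  - by rewrite -frame; exact: pS.
  - rewrite -frame => px1; rewrite leNgt; apply/negP => v0; apply: Nv.
    by exists x.
  - move=> v0; apply/negP => /eqP u1; apply: Nu; exists x => //.
    apply/eqP; rewrite -subr_eq0; apply/eqP/dot_eq0.
    rewrite frame; move: v0 u1; rewrite !dotBr !dotDr uu vu => v0 u1.
    have -> : dot v p - (dot v x + 0) = 0 by lra.
    have -> : dot u p - (dot u x + 1) = 0 by lra.
    by rewrite mulr0 addr0.
  exists e => // t t0 te y; rewrite inE => /eqP ->.
  have := He t t0 te; rewrite frame !dotBr !dotDr !dotZr uu vv uv vu; lra.
have := ptop _ (fun x xS => tS x xS x (mem_head x [::])).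
rewrite !dotDr !dotZr uu uv; nra.
Qed.

(** * Width in a given direction *)

(** Measured from the center [p - u], the point [p] has height 1 and the lowest level is at most
    [center_vertex_dist d]. *)
Lemma arc_width {R : realType} (S : seq (plane R)) (d : R)
    (p q u : plane R) :
  1 <= d -> d < Num.sqrt 3 ->
  (forall x y, x \in S -> y \in S -> dot (x - y) (x - y) <= d * d) ->
  dot u u = 1 -> p - u \in S -> disks_inter S p ->
  (forall z, disks_inter S z -> dot u q <= dot u z) ->
  1 - center_vertex_dist d <= dot u (p - q).
Proof.
move=> d1 d3 Sd uu cS pS qbot.
have [|z /qbot zq] := low_point S d (p - u) u d1 d3 Sd uu cS.
  by rewrite subrK.
by rewrite !dotBr uu; lra.
Qed.

(* The new direction is [p - x]; it lies between [u] and [y - q], so [q] stays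
   the lowest point. *)
Lemma rotated_width {R : realType} (S : seq (plane R)) (d : R)
    (p q u v x y : plane R) :
  1 <= d -> d < Num.sqrt 3 ->
  (forall x y, x \in S -> y \in S -> dot (x - y) (x - y) <= d * d) ->
  dot u u = 1 -> dot v v = 1 -> dot u v = 0 -> dot v (p - q) <= 0 ->
  disks_inter S p -> disks_inter S q ->
  (forall z, disks_inter S z -> dot u q <= dot u z) ->
  x \in S -> dot (p - x) (p - x) = 1 -> 0 < dot v (p - x) ->
  y \in S -> dot (y - q) (y - q) = 1 -> 0 < dot v (y - q) ->
  dot u (y - q) * dot v (p - x) <= dot u (p - x) * dot v (y - q) ->
  1 - center_vertex_dist d <= dot u (p - q).
Proof.
move=> d1 d3 Sd uu vv uv vpq pS qS qbot xS px vpx yS yq vyq slope.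
have frame r s := dot_frame u v r s uu vv uv.
have ub : dot u (p - x) <= 1.
  apply: le_sqr => //; move: px; rewrite frame => px; rewrite mulr1.
  have := sqr_ge0 (dot v (p - x)); rewrite expr2; lra.
have upq : 0 <= dot u (p - q) by rewrite dotBr subr_ge0; exact: qbot.
apply: (@le_trans _ _ (dot (p - x) (p - q))).
  apply: (arc_width S) => //; first by rewrite opprB addrC subrK.
  move=> z zS; rewrite -subr_ge0 -dotBr.
  have uz : 0 <= dot u (z - q) by rewrite dotBr subr_ge0; exact: qbot.
  (* [y - q] is the inner normal at [q] of the disk around [y], which contains [z]. *)
  have nz : 0 <= dot (y - q) (z - q).
    have zy := zS y yS; have := dot_ge0 (z - q).
    have : dot (z - y) (z - y) =
      dot (z - q) (z - q) - 2 * dot (y - q) (z - q) + dot (y - q) (y - q).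
      by rewrite /dot /=; ring.
    lra.
  rewrite -(pmulr_rge0 _ vyq).
  (* Up to a positive factor, [p - x] is a non-negative combination of [u] and [y - q]; [slope]
     gives the sign. *)
  have -> : dot v (y - q) * dot (p - x) (z - q) =
    (dot u (p - x) * dot v (y - q) - dot u (y - q) * dot v (p - x)) * dot u (z - q)
    + dot v (p - x) * dot (y - q) (z - q).
    by rewrite (frame (p - x)) (frame (y - q)); ring.
  by apply: addr_ge0; apply: mulr_ge0 => //; lra.
rewrite frame; nra.
Qed.

Lemma disks_inter_width {R : realType} (S : seq (plane R)) (d : R)
    (p q u : plane R) :
  1 <= d -> d < Num.sqrt 3 ->
  (forall x y, x \in S -> y \in S -> dot (x - y) (x - y) <= d * d) ->
  dot u u = 1 -> disks_inter S p -> disks_inter S q ->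
  (forall z, disks_inter S z -> dot u q <= dot u z) ->
  (forall z, disks_inter S z -> dot u z <= dot u p) ->
  1 - center_vertex_dist d <= dot u (p - q).
Proof.
move=> d1 d3 Sd uu pS qS qbot ptop.
have [v [vv uv vpq]] := frame_ex u (p - q) uu.
have Nuu : dot (- u) (- u) = 1 by rewrite dotNl dotNr opprK.
have Nvv : dot (- v) (- v) = 1 by rewrite dotNl dotNr opprK.
have Nuv : dot (- u) (- v) = 0 by rewrite dotNl dotNr opprK.
have Nqtop z : disks_inter S z -> dot (- u) z <= dot (- u) q.
  by rewrite !dotNl lerN2; exact: qbot.
have Npbot z : disks_inter S z -> dot (- u) p <= dot (- u) z.
  by rewrite !dotNl lerN2; exact: ptop.
have NB (r s w : plane R) : dot (- r) (s - w) = dot r (w - s).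
  by rewrite dotNl -dotNr opprB.
have [[x xS pE]|[x [xS px vpx]]] := top_point_normal S p u v uu vv uv pS ptop.
  by apply: (arc_width S) => //; rewrite pE addrK.
have [[y yS qE]|[y [yS qy vyq]]] :=
    top_point_normal S q (- u) (- v) Nuu Nvv Nuv qS Nqtop.
  by rewrite -NB; apply: (arc_width S) => //; rewrite qE addrK.
have yq : dot (y - q) (y - q) = 1 by rewrite -opprB dotNl dotNr opprK.
(* Compares the angles from [u] to [p - x] and to [y - q]: the normal reached first decides whether
   the arc at [p] or the one at [q] is used. The second case exchanges [p] and [q] by negating the
   frame. *)
have [slope|/ltW slope] := leP (dot u (y - q) * dot v (p - x))
    (dot u (p - x) * dot v (y - q)).
  apply: (rotated_width S d p q u v x y) => //.
  by rewrite -NB.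
rewrite -NB; apply: (rotated_width S d q p (- u) (- v) y x) => //.
- by rewrite NB.
- by rewrite -opprB dotNl dotNr opprK.
- by rewrite NB.
- by rewrite !NB.
Qed.

(** * Compactness and existence of extreme points *)

Lemma continuous_dot {R : realType} (f g : plane R -> plane R) :
  continuous f -> continuous g -> continuous (fun p => dot (f p) (g p)).
Proof.
move=> cf cg p; rewrite /dot.
have fst_cont (h : plane R -> plane R) :
    continuous h -> continuous (fun p => (h p).1).
  by move=> ch q; apply: cvg_comp (ch q) _; exact: cvg_fst.
have snd_cont (h : plane R -> plane R) :
    continuous h -> continuous (fun p => (h p).2).
  by move=> ch q; apply: cvg_comp (ch q) _; exact: cvg_snd.
by apply: cvgD; apply: cvgM;
  [apply: fst_cont|apply: fst_cont|apply: snd_cont|apply: snd_cont].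
Qed.

Lemma disks_inter_compact {R : realType} (S : seq (plane R)) (x : plane R) :
  x \in S -> compact (disks_inter S : set (plane R)).
Proof.
move=> xS; pose box := `[x.1 - 1, x.1 + 1] `*` `[x.2 - 1, x.2 + 1].
apply: (@subclosed_compact _ _ box).
- rewrite (_ : disks_inter S = \bigcap_(y in [set` S])
      ((fun p => dot (p - y) (p - y)) @^-1` [set r | r <= 1])); last first.
    by apply/seteqP; split.
  apply: closed_bigI => y _; apply: preimage_closed; last exact: closed_le.
  move=> p _; apply: continuous_dot => q;
    apply: cvgB; by [exact: cvg_id|exact: cvg_cst].
- by apply: compact_setX; exact: segment_compact.
- move=> p /(_ x xS); rewrite /dot /= => h;
    split; rewrite /= in_itv /=; apply/andP; split.
  + rewrite leNgt; apply/negP => ?.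
    by have := sqr_ge0 (p.2 - x.2); rewrite expr2; nra.
  + rewrite leNgt; apply/negP => ?.
    by have := sqr_ge0 (p.2 - x.2); rewrite expr2; nra.
  + rewrite leNgt; apply/negP => ?.
    by have := sqr_ge0 (p.1 - x.1); rewrite expr2; nra.
  + rewrite leNgt; apply/negP => ?.
    by have := sqr_ge0 (p.1 - x.1); rewrite expr2; nra.
Qed.

Lemma compact_dot_max {R : realType} (C : set (plane R)) (u : plane R) :
  C !=set0 -> compact C -> exists2 p, C p & forall z, C z -> dot u z <= dot u p.
Proof.
move=> C0 cC; have [|p pC pm] := @compact_EVT_max _ _ (dot u) _ C0 cC.
  apply: continuous_subspaceT; apply: continuous_dot => q;
    by [exact: cvg_cst|exact: cvg_id].
by exists p; [exact/set_mem|move=> z /mem_set; exact: pm].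
Qed.

(** * Slabs between parallel supporting lines *)

Lemma le_dot_edist {R : realType} (u p q : plane R) : dot u u = 1 ->
  `|dot u (p - q)| <= Defs.edist p q.
Proof.
move=> uu; have [v [vv uv _]] := frame_ex u 0 uu.
rewrite /Defs.edist -sqrtr_sqr; apply: ler_wsqrtr.
rewrite (dot_frame u v (p - q) (p - q) uu vv uv) [leLHS]expr2.
by rewrite lerDr -expr2 sqr_ge0.
Qed.

Lemma set_dist_lines {R : realType} (u : plane R) (a b : R) : dot u u = 1 ->
  set_dist (line u a) (line u b) = `|a - b|.
Proof.
move=> uu; have onl (r : R) : dot u (r *: u) = r by rewrite dotZr uu mulr1.
have lb : lbound [set Defs.edist p q | p in line u a & q in line u b] `|a - b|.
  by move=> _ [p pa [q qb <-]]; rewrite -pa -qb -dotBr; exact: le_dot_edist.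
have mem : [set Defs.edist p q | p in line u a & q in line u b] `|a - b|.
  exists (a *: u); first exact: onl.
  exists (b *: u); first exact: onl.
  by rewrite /Defs.edist -scalerBl dotZr dotC dotZr uu mulr1 -expr2 sqrtr_sqr.
apply/le_anti/andP; split; first by apply: ge_inf => //; exists `|a - b|.
by apply: lb_le_inf => //; exists `|a - b|.
Qed.

(* [minimal_width C] is the infimum of this set. *)
Definition slab_width {R : realType} (C : set (plane R)) : set R :=
  [set w | exists (u : plane R) (a b : R),
     [/\ dot u u = 1, a != b, supporting_line C u a, supporting_line C u b &
         w = set_dist (line u a) (line u b)]].

Lemma slab_width_mem {R : realType} (C : set (plane R)) (u p q : plane R) :
  dot u u = 1 -> C p -> C q ->
  (forall z, C z -> dot u q <= dot u z) -> (forall z, C z -> dot u z <= dot u p) ->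
  0 < dot u (p - q) -> slab_width C (dot u (p - q)).
Proof.
move=> uu pC qC qbot ptop; rewrite dotBr subr_gt0 => qp.
exists u, (dot u p), (dot u q); split=> //.
- by rewrite gt_eqF.
- by split; [exists p | left].
- by split; [exists q | right].
- by rewrite set_dist_lines // gtr0_norm // subr_gt0.
Qed.

(** Two parallel supporting lines with [C] on the same side of both would coincide, against
    [a != b]; so one touches [C] at a highest point and the other at a lowest. *)
Lemma slab_width_inv {R : realType} (C : set (plane R)) (w : R) :
  slab_width C w -> exists u p q, [/\ dot u u = 1 /\ w = dot u (p - q), C p, C q,
    forall z, C z -> dot u q <= dot u z & forall z, C z -> dot u z <= dot u p].
Proof.
case=> u [a [b [uu ab [[p [pC pa]] sa] [[q [qC qb]] sb] ->]]].
rewrite set_dist_lines // -pa -qb -dotBr; move: sa sb ab; rewrite -pa -qb.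
move=> [ha|ha] [hb|hb].
- by have := ha _ qC; have := hb _ pC => /= h1 h2; rewrite eq_le h1 h2.
- move=> _; exists u, p, q; split=> //; split=> //.
  by rewrite ger0_norm // dotBr subr_ge0; exact: ha.
- move=> _; exists u, q, p; split=> //; split=> //.
  by rewrite ler0_norm -?dotNr ?opprB // dotBr subr_le0; exact: ha.
- by have := ha _ qC; have := hb _ pC => /= h1 h2; rewrite eq_le h1 h2.
Qed.

(** * The regular disk-triangle *)

(** The direction [u] is the axis from [a] to the midpoint [m] of [b] and [c]. The highest point is
    [a + u], and the lowest is the vertex [m - k *: u], where the circles around [b] and [c]
    meet. *)
Lemma regular_disk_triangle_width {R : realType} (d : R) (T : set (plane R)) :
  1 <= d -> d < Num.sqrt 3 -> regular_disk_triangle d T ->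
  slab_width T (1 - center_vertex_dist d).
Proof.
move=> d1 dr [a [b [c [ab bc ca ->]]]].
have s1 := center_vertex_dist_lt1 d d1 dr.
have [r re [r0 r3]] := @sqrt_spec R 3 ltac:(lra).
rewrite re in dr.
have k2 : 0 <= 1 - d * d / 4 by nra.
have [k ke [k0 kE]] := sqrt_spec _ k2.
rewrite /center_vertex_dist expr2 re ke in s1 *.
have d0 : 0 <= d by lra.
have sqd (p q : plane R) : Defs.edist p q = d -> dot (p - q) (p - q) = d * d.
  by move=> <-; rewrite /Defs.edist -expr2 sqr_sqrtr ?dot_ge0.
have {ab} ab := sqd _ _ ab; have {bc} bc := sqd _ _ bc; have {ca sqd} ca := sqd _ _ ca.
pose m := 2^-1 *: (b + c); pose h := r / 2 * d.
have hp : 0 < h by rewrite /h; apply: mulr_gt0; lra.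
have hne : h != 0 by rewrite gt_eqF.
pose u := h^-1 *: (m - a).
have mE : m = a + h *: u by rewrite /u scalerA mulfV // scale1r addrC subrK.
have mb : m - b = 2^-1 *: (c - b).
  by rewrite /m; apply/pair_equal_spec; split; do 2 rewrite /GRing.scale /=; field.
have mc : m - c = - (m - b).
  by rewrite /m; apply/pair_equal_spec; split; do 2 rewrite /GRing.scale /=; field.
have mab : m - a = (b - a) + (m - b) by rewrite [RHS]addrC addrA subrK.
have bcc : dot (c - b) (c - b) = d * d by rewrite -opprB dotNl dotNr opprK.
have baa : dot (b - a) (b - a) = d * d by rewrite -opprB dotNl dotNr opprK.
have bac : dot (b - a) (c - b) = - (d * d / 2).
  have : dot (c - a) (c - a) =
      dot (b - a) (b - a) + 2 * dot (b - a) (c - b) + dot (c - b) (c - b).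
    by rewrite /dot /=; ring.
  lra.
have mbb : dot (m - b) (m - b) = d * d / 4.
  by rewrite mb dotZr dotC dotZr bcc; field.
have um : dot (m - a) (m - b) = 0.
  by rewrite mab dotDl mbb mb dotZr bac; field.
have maa : dot (m - a) (m - a) = h * h.
  rewrite {2}mab dotDr um addr0 mab dotDl baa (dotC (m - b)) mb dotZr bac /h.
  have -> : r / 2 * d * (r / 2 * d) = r * r * d * d / 4 by field.
  by rewrite r3; field.
have uu : dot u u = 1.
  by rewrite /u dotZr dotC dotZr maa; field.
have ub : dot u (m - b) = 0 by rewrite /u dotC dotZr dotC um mulr0.
clearbody u m.
have inT p : dot (p - a) (p - a) <= 1 -> dot (p - b) (p - b) <= 1 ->
    dot (p - c) (p - c) <= 1 -> disk_inter [set a; b; c] p.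
  by move=> pa pb pc x [[->|->]|->]; rewrite /unit_disk /= plane_edist_le // mulr1.
have vert l w : dot u w = 0 -> dot (l *: u + w) (l *: u + w) = l * l + dot w w.
  move=> uw; transitivity (l * l * dot u u + 2 * l * dot u w + dot w w).
    by rewrite /dot /=; do ?rewrite /GRing.scale /=; ring.
  by rewrite uu uw; ring.
have decb p l : p = m + l *: u -> dot (p - b) (p - b) = l * l + d * d / 4.
  by move=> ->; rewrite addrAC addrC vert ?mbb.
have decc p l : p = m + l *: u -> dot (p - c) (p - c) = l * l + d * d / 4.
  by move=> ->; rewrite addrAC addrC mc vert dotNr ?dotNl ?opprK ?mbb // ub oppr0.
have -> : 1 - (r / 2 * d - k) = dot u ((a + u) - (m - k *: u)).
  by rewrite mE !dotBr !dotDr !dotZr uu /h; ring.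
have auE : a + u = m + (1 - h) *: u.
  by rewrite mE -addrA -scalerDl addrCA subrr addr0 scale1r.
(* The left side equals [1 - r * d + d * d], so this amounts to [d <= r]. *)
have top0 : (1 - h) * (1 - h) + d * d / 4 <= 1.
  have -> : (1 - h) * (1 - h) = 1 - r * d + r * r * d * d / 4 by rewrite /h; field.
  rewrite r3; nra.
apply: slab_width_mem => //.
- apply: inT; first by rewrite addrAC subrr add0r uu.
    by rewrite (decb _ _ auE).
  by rewrite (decc _ _ auE).
- apply: inT.
  + have -> : m - k *: u - a = (h - k) *: u.
      by rewrite mE scalerBl addrAC [a + _]addrC addrK.
    have hh : h * h = 3 * (d * d) / 4 by rewrite -r3 /h; field.
    have kh : k <= h by apply: le_sqr; [exact: ltW | nra].
    have h1 : h - k < 1 by [].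
    rewrite dotZr dotC dotZr uu mulr1; clearbody h; nra.
  + by rewrite (decb _ (- k)) ?scaleNr //; nra.
  + by rewrite (decc _ (- k)) ?scaleNr //; nra.
- move=> z zT; have := zT b; have := zT c; rewrite /unit_disk /= !plane_edist_le // mulr1.
  move=> /(_ (or_intror erefl)) zc /(_ (or_introl (or_intror erefl))) zb.
  (* By the parallelogram law, the lens of [b] and [c] lies in the disk of radius [k] around [m]. *)
  have zm : dot (z - m) (z - m) <= k * k.
    have : dot (z - b) (z - b) + dot (z - c) (z - c) =
        2 * dot (z - m) (z - m) + 2 * dot (m - b) (m - b).
      have -> : z - b = (z - m) + (m - b) by rewrite addrA subrK.
      have -> : z - c = (z - m) - (m - b) by rewrite -mc addrA subrK.
      by rewrite /dot /=; ring.
    rewrite mbb; lra.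
  have uz : `|dot u (z - m)| <= k.
    apply: le_trans (le_dot_edist _ _ _ uu) _.
    by rewrite plane_edist_le.
  move: uz; rewrite ler_norml => /andP[uz _].
  by move: uz; rewrite !dotBr dotZr uu; lra.
- move=> z /(_ a (or_introl (or_introl erefl))); rewrite /unit_disk /=.
  move=> /(le_trans (le_dot_edist _ _ _ uu)); rewrite ler_norml => /andP[_].
  by rewrite dotBr dotDr uu; lra.
- by rewrite mE !dotBr !dotDr !dotZr uu /h; lra.
Qed.

(** * Comparison of the minimal widths *)

Theorem lemma1p9 (R : realType) (d : R) (D T : set (plane R))
    (hd1 : 1 <= d) (hd3 : d < Num.sqrt 3)
    (hD : center_param_family d D) (hT : regular_disk_triangle d T) :
  minimal_width T <= minimal_width D.
Proof.
case: hD => X [[[/finite_seqP[S XE] [c Xc]] DE D0 _] Xd].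
have cS : c \in S by move: Xc; rewrite XE.
have Sd x y : x \in S -> y \in S -> dot (x - y) (x - y) <= d * d.
  by move=> xS yS; rewrite -plane_edist_le ?Xd ?XE //; lra.
have DS : D = disks_inter S.
  rewrite DE XE; apply/seteqP; split=> p pS x /pS; rewrite /unit_disk /=.
    by rewrite plane_edist_le // mulr1.
  by rewrite plane_edist_le // mulr1.
have {}D0 : D !=set0 by case: D0 => p /interior_subset; exists p.
have s1 := center_vertex_dist_lt1 d hd1 hd3.
apply: (@le_trans _ _ (1 - center_vertex_dist d)).
  apply: ge_inf; last exact: regular_disk_triangle_width.
  by exists 0 => w /slab_width_inv[u [p [q [[_ ->] ? qC _ ptop]]]];
    rewrite dotBr subr_ge0 ptop.
apply: lb_le_inf.
  have cD : compact D by rewrite DS; exact: disks_inter_compact cS.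
  (* The lower bound passes to the infimum only for a non-empty set of widths. Any direction
     supplies a member: its width is at least [1 - center_vertex_dist d], hence positive, so the two
     lines are distinct. *)
  pose u : plane R := (1, 0).
  have uu : dot u u = 1 by rewrite /dot /=; ring.
  have [p pD ptop] := compact_dot_max D u D0 cD.
  have [q qD qbot] := compact_dot_max D (- u) D0 cD.
  have {}qbot z : D z -> dot u q <= dot u z.
    by move=> /qbot; rewrite !dotNl lerN2.
  exists (dot u (p - q)); apply: slab_width_mem => //.
  apply: lt_le_trans (disks_inter_width S d p q u _ _ _ _ _ _ _ _) => //;
    rewrite -?DS //; lra.
move=> w /slab_width_inv[u [p [q [[uu ->] pD qD qbot ptop]]]].
by apply: (disks_inter_width S) => //; rewrite -?DS.
Qed.
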